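(* The following statements are equivalent for any quandle $Q$: (i) $Q$ embeds in $\operatorname{Conj}(H)$ for some group $H$ (that is, there is an injective quandle homomorphism $Q\to\operatorname{Conj}(H)$). (ii) The natural map $\eta:Q\to\operatorname{Env}(Q)$, $\eta(x)=e_x$, is injective. (iii) $Q\cong\mathcal{D}(S^G)$ for some group $G$ and some generating set $S$ of $G$.
   Context: A quandle is a non-empty set $Q$ with a binary operation $*$ such that: (i) $x*x=x$ for all $x$; (ii) for all $x,y\in Q$ there is a unique $z\in Q$ with $x=z*y$; (iii) $(x*y)*z=(x*z)*(y*z)$ for all $x,y,z$. A quandle homomorphism is a map preserving $*$. For a group $H$, the conjugation quandle $\operatorname{Conj}(H)$ is the set $H$ with $x*y=yxy^{-1}$. For a group $G$ and a non-empty subset $A\subseteq G$, let $A^G$ be the set of all conjugates in $G$ of elements of $A$. The Dehn quandle $\mathcal{D}(A^G)$ is the set $A^G$ with the operation $x*y=yxy^{-1}$. The enveloping group $\operatorname{Env}(Q)$ of a quandle $Q$ is the group with generators $\{e_x\mid x\in Q\}$ and defining relations $e_{x*y}=e_ye_xe_y^{-1}$ for all $x,y\in Q$. *)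

(* Defs.v *)
From HB Require Import structures.
From mathcomp Require Import all_boot.
From mathcomp Require Import boolp classical_sets.

Set Implicit Arguments.
Unset Strict Implicit.
Unset Printing Implicit Defensive.

Local Open Scope classical_set_scope.
Local Open Scope quotient_scope.
Local Open Scope group_scope.

(* The carrier is an arbitrary [Type]: no decidable equality or choice        *)
(* operator is assumed on a quandle.                                          *)
HB.mixin Record isQuandle (Q : Type) := {
  qop : Q -> Q -> Q;
  quandle_inhabited : inhabited Q;
  qopxx : forall x : Q, qop x x = x;
  qop_div : forall x y : Q, exists! z : Q, x = qop z y;
  qopDl : forall x y z : Q, qop (qop x y) z = qop (qop x z) (qop y z)
}.

#[short(type="quandleType")]
HB.structure Definition Quandle := {Q of isQuandle Q}.

Definition quandle_hom (P Q : quandleType) (f : P -> Q) : Prop :=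
  {morph f : x y / qop x y}.

Definition quandle_embeds (P Q : quandleType) : Prop :=
  exists f : P -> Q, quandle_hom f /\ injective f.

Definition quandle_iso (P Q : quandleType) : Prop :=
  exists f : P -> Q, quandle_hom f /\ bijective f.

Section ConjQuandle.
Variable H : groupType.

Definition Conj : Type := H.

Definition conj_op (x y : Conj) : Conj := (y : H) * (x : H) * (y : H)^-1.

Lemma conj_opxx x : conj_op x x = x.
Proof. by rewrite /conj_op mulgK. Qed.

Lemma conj_op_div x y : exists! z, x = conj_op z y.
Proof.
exists ((y : H)^-1 * (x : H) * (y : H)); split.
  by rewrite /conj_op !mulgA mulgV mul1g mulgK.
by move=> z ->; rewrite /conj_op !mulgA mulVg mul1g mulgVK.
Qed.

Lemma conj_opDl x y z :
  conj_op (conj_op x y) z = conj_op (conj_op x z) (conj_op y z).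
Proof. by rewrite /conj_op !invgM invgK !mulgA !mulgVK. Qed.

HB.instance Definition _ := isQuandle.Build Conj
  (inhabits (1 : H)) conj_opxx conj_op_div conj_opDl.

End ConjQuandle.

Section DehnQuandle.
Variable G : groupType.

Definition conjugates (A : set G) : set G :=
  [set g * a * g^-1 | a in A & g in [set: G]].

Lemma conjugatesJ (A : set G) (x y : G) :
  x \in conjugates A -> y * x * y^-1 \in conjugates A.
Proof.
rewrite !inE => -[a Aa [g _ <-]]; exists a => //; exists (y * g) => //.
by rewrite invgM !mulgA.
Qed.

Lemma conjugatesJV (A : set G) (x y : G) :
  x \in conjugates A -> y^-1 * x * y \in conjugates A.
Proof. by move=> /(@conjugatesJ _ _ y^-1); rewrite invgK. Qed.

Variables (A : set G) (A0 : A !=set0).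

Definition Dehn of A !=set0 : Type := conjugates A.

Local Notation D := (Dehn A0).

Definition dehn_op (x y : D) : D :=
  exist _ (val y * val x * (val y)^-1) (conjugatesJ (val y) (valP x)).

Lemma dehn_inhabited : inhabited D.
Proof.
case: A0 => a Aa; suff aA : a \in conjugates A by exact: inhabits (exist _ a aA).
by rewrite inE; exists a => //; exists 1 => //; rewrite invg1 mul1g mulg1.
Qed.

Lemma dehn_opxx (x : D) : dehn_op x x = x.
Proof. by apply: val_inj; rewrite /= mulgK. Qed.

Lemma dehn_op_div (x y : D) : exists! z : D, x = dehn_op z y.
Proof.
exists (exist _ ((val y)^-1 * val x * val y) (conjugatesJV (val y) (valP x))).
split=> [|z ->]; apply: val_inj => /=.
  by rewrite !mulgA mulgV mul1g mulgK.
by rewrite !mulgA mulVg mul1g mulgVK.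
Qed.

Lemma dehn_opDl (x y z : D) :
  dehn_op (dehn_op x y) z = dehn_op (dehn_op x z) (dehn_op y z).
Proof. by apply: val_inj => /=; rewrite !invgM invgK !mulgA !mulgVK. Qed.

HB.instance Definition _ := isQuandle.Build D
  dehn_inhabited dehn_opxx dehn_op_div dehn_opDl.

End DehnQuandle.

Section Generation.
Variable G : groupType.

Definition subgroup (H : set G) : Prop :=
  [/\ H 1, forall x y, H x -> H y -> H (x * y) & forall x, H x -> H x^-1].

Definition generates (S : set G) : Prop := smallest subgroup S = [set: G].

End Generation.

(* The group < X | u = v for all u, v with R u v >: words in the letters      *)
(* x = (x, false) and x^-1 = (x, true), modulo the congruence generated by    *)
(* free cancellation and the relations R.                                     *)
Section Presentation.
Variable X : Type.

Definition word := seq (X * bool).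

Definition winv (w : word) : word := rev [seq (l.1, ~~ l.2) | l <- w].

Variable R : word -> word -> Prop.

Inductive wcong : word -> word -> Prop :=
| wcong_refl u : wcong u u
| wcong_sym u v : wcong u v -> wcong v u
| wcong_trans u v w : wcong u v -> wcong v w -> wcong u w
| wcong_cancel u v x b : wcong (u ++ [:: (x, b); (x, ~~ b)] ++ v) (u ++ v)
| wcong_rel u v r s : R r s -> wcong (u ++ r ++ v) (u ++ s ++ v).

Lemma wcong_ctx p q u v : wcong u v -> wcong (p ++ u ++ q) (p ++ v ++ q).
Proof.
elim=> {u v} [u|u v _|u v w _ uv _|u v x b|u v r s Rrs].
- exact: wcong_refl.
- exact: wcong_sym.
- exact: wcong_trans.
- by have := wcong_cancel (p ++ u) (v ++ q) x b; rewrite -!catA.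
- by have := wcong_rel (p ++ u) (v ++ q) Rrs; rewrite -!catA.
Qed.

Lemma wcong_cat u u' v v' : wcong u u' -> wcong v v' -> wcong (u ++ v) (u' ++ v').
Proof.
move=> uu' vv'; have := wcong_ctx u' [::] vv'; rewrite !cats0.
exact: wcong_trans (wcong_ctx [::] v uu').
Qed.

Lemma winv_cat u v : winv (u ++ v) = winv v ++ winv u.
Proof. by rewrite /winv map_cat rev_cat. Qed.

Lemma winvK : involutive winv.
Proof.
move=> u; rewrite /winv map_rev revK -map_comp -[RHS]map_id.
by apply: eq_map => -[x b] /=; rewrite negbK.
Qed.

Lemma wcong_winvr u : wcong (u ++ winv u) [::].
Proof.
elim: u => [|[x b] u IH]; first exact: wcong_refl.
rewrite -cat1s winv_cat -catA (catA u).
apply: wcong_trans (wcong_ctx [:: (x, b)] (winv [:: (x, b)]) IH) _.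
exact: (wcong_cancel [::] [::] x b).
Qed.

Lemma wcong_winvl u : wcong (winv u ++ u) [::].
Proof. by rewrite -{2}(winvK u); apply: wcong_winvr. Qed.

Lemma wcong_winv u v : wcong u v -> wcong (winv u) (winv v).
Proof.
move=> uv; have /wcong_sym := wcong_cat (wcong_refl (winv u)) (wcong_winvr v).
rewrite cats0 => h; apply: wcong_trans h _.
have := wcong_ctx (winv u) (winv v) (wcong_sym uv) => h.
apply: wcong_trans h _; rewrite catA.
exact: wcong_cat (wcong_winvl u) (wcong_refl _).
Qed.

Definition wcongb : rel {classic word} := fun u v => `[< wcong u v >].

Lemma wcongb_refl : reflexive wcongb.
Proof. by move=> u; apply/asboolP; apply: wcong_refl. Qed.

Lemma wcongb_sym : symmetric wcongb.
Proof. by move=> u v; apply: asbool_equiv_eq; split; apply: wcong_sym. Qed.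

Lemma wcongb_trans : transitive wcongb.
Proof.
by move=> v u w /asboolP uv /asboolP vw; apply/asboolP; apply: wcong_trans vw.
Qed.

Canonical wcongb_equiv := EquivRel wcongb wcongb_refl wcongb_sym wcongb_trans.

Definition presented := {eq_quot wcongb}.
HB.instance Definition _ := Choice.on presented.

Definition pres_class (w : word) : presented := \pi_{eq_quot wcongb} w.

Lemma pres_classP u v : pres_class u = pres_class v <-> wcong u v.
Proof.
by split=> [/eqmodP/asboolP|uv] //; apply/eqmodP/asboolP.
Qed.

Definition pres_repr (a : presented) : word := repr (a : {eq_quot wcongb}).

Lemma pres_reprK a : pres_class (pres_repr a) = a.
Proof. exact: reprK. Qed.

Definition pres_one : presented := pres_class [::].
Definition pres_mul (a b : presented) : presented :=
  pres_class (pres_repr a ++ pres_repr b).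
Definition pres_inv (a : presented) : presented :=
  pres_class (winv (pres_repr a)).

Lemma wcong_repr w : wcong (pres_repr (pres_class w)) w.
Proof. by apply/pres_classP; rewrite pres_reprK. Qed.

Lemma pres_mulE u v :
  pres_mul (pres_class u) (pres_class v) = pres_class (u ++ v).
Proof. by apply/pres_classP/wcong_cat; apply: wcong_repr. Qed.

Lemma pres_invE u : pres_inv (pres_class u) = pres_class (winv u).
Proof. by apply/pres_classP/wcong_winv/wcong_repr. Qed.

Lemma pres_mulA : associative pres_mul.
Proof.
move=> a b c; rewrite -(pres_reprK a) -(pres_reprK b) -(pres_reprK c).
by rewrite !pres_mulE catA.
Qed.

Lemma pres_mul1 : left_id pres_one pres_mul.
Proof. by move=> a; rewrite -(pres_reprK a) pres_mulE. Qed.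

Lemma pres_mulr1 : right_id pres_one pres_mul.
Proof. by move=> a; rewrite -(pres_reprK a) pres_mulE cats0. Qed.

Lemma pres_mulV : left_inverse pres_one pres_inv pres_mul.
Proof.
move=> a; rewrite -(pres_reprK a) pres_invE pres_mulE.
exact/pres_classP/wcong_winvl.
Qed.

Lemma pres_mulrV : right_inverse pres_one pres_inv pres_mul.
Proof.
move=> a; rewrite -(pres_reprK a) pres_invE pres_mulE.
exact/pres_classP/wcong_winvr.
Qed.

HB.instance Definition _ := isGroup.Build presented
  pres_mulA pres_mul1 pres_mulr1 pres_mulV pres_mulrV.

End Presentation.

Section EnvelopingGroup.
Variable Q : quandleType.

Inductive env_rel : word Q -> word Q -> Prop :=
| EnvRel x y :
    env_rel [:: (qop x y, false)] [:: (y, false); (x, false); (y, true)].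

Definition Env : groupType := presented env_rel.

Definition env_eta (x : Q) : Env := pres_class env_rel [:: (x, false)].

End EnvelopingGroup.

(* Main.v *)
Require Import Defs.
From mathcomp Require Import all_boot.
From mathcomp Require Import boolp classical_sets.

(** A map [f] from [Q] to a group [H] is a quandle homomorphism into [Conj H]
    exactly when it satisfies the defining relations of [Env Q], so it factors
    through [env_eta]: if [f] is injective, then so is [env_eta]
    ([env_eta_inj_of_embedding]).

    When [env_eta] is injective it identifies [Q] with the set [S] of generators
    of [Env Q], and the point is that closing [S] under conjugation adds
    nothing. The elements [g] for which both [g] and [g^-1] conjugate [S] into
    itself form a subgroup. It contains [S]: conjugation by the image of [y]
    is the image of right translation by [y], and right translations of a
    quandle are surjective, which takes care of the inverse. As [S] generates,
    this subgroup is everything ([conjugates_range]), so that [Q] is isomorphic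
    to the Dehn quandle of [S] ([dehn_iso_of_embedding]).

    Finally a Dehn quandle is by construction a subquandle of the conjugation
    quandle of its ambient group. *)

Set Implicit Arguments.
Unset Strict Implicit.
Unset Printing Implicit Defensive.

Local Open Scope classical_set_scope.
Local Open Scope group_scope.

Section Evaluation.
Variables (X : Type) (H : groupType) (f : X -> H).

Definition letter_eval (l : X * bool) : H := if l.2 then (f l.1)^-1 else f l.1.

Definition word_eval (w : word X) : H :=
  foldr (fun l h => letter_eval l * h) 1 w.

Lemma word_eval_cat u v : word_eval (u ++ v) = word_eval u * word_eval v.
Proof. by elim: u => [|l u IH] /=; rewrite ?mul1g // IH mulgA. Qed.

(** The universal property of a presentation (von Dyck): a map on the
    generators that satisfies the relations is well defined on classes. *)
Lemma word_eval_wcong (R : word X -> word X -> Prop) u v :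
    (forall r s, R r s -> word_eval r = word_eval s) ->
  wcong R u v -> word_eval u = word_eval v.
Proof.
move=> evalR; elim=> {u v} [//|u v _ -> //|u v w _ -> _ -> //|u v x b|u v r s].
  by case: b; rewrite !word_eval_cat /= /letter_eval /= mulg1 ?mulgV ?mulVg mul1g.
by move=> /evalR; rewrite !word_eval_cat => ->.
Qed.

End Evaluation.

Section EnvelopingGroup.
Variable Q : quandleType.

Lemma env_eta_hom : quandle_hom (@env_eta Q : Q -> Conj (Env Q)).
Proof.
move=> x y; transitivity (pres_class (@env_rel Q)
  [:: (y, false); (x, false); (y, true)]).
  by apply/pres_classP; apply: (wcong_rel [::] [::] (EnvRel x y)).
symmetry; change (pres_mul (pres_mul (env_eta y) (env_eta x))
  (pres_inv (env_eta y)) = pres_class (@env_rel Q)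
  [:: (y, false); (x, false); (y, true)]).
by rewrite /env_eta pres_invE !pres_mulE.
Qed.

Lemma env_eta_inj_of_embedding (H : groupType) :
  quandle_embeds Q (Conj H) -> injective (@env_eta Q).
Proof.
case=> f [f_hom f_inj] x y /pres_classP xy; apply: f_inj.
have /(_ (f : Q -> H)) := word_eval_wcong (H := H) _ xy.
rewrite /= /letter_eval /= !mulg1; apply=> _ _ [a b].
by rewrite /= /letter_eval /= !mulg1 f_hom mulgA.
Qed.

Lemma env_eta_generates : generates (range (@env_eta Q)).
Proof.
rewrite /generates -subTset => g _ K [[K1 KM KV] etaK].
rewrite -[g]pres_reprK; elim: (pres_repr g) => [|[x b] w IH]; first exact: K1.
have Kx : K (env_eta x) by apply: etaK; exists x.
rewrite -cat1s -pres_mulE; apply: KM => //; case: b => //.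
by have := KV _ Kx; rewrite -[X in K X]/(pres_inv _) pres_invE.
Qed.

End EnvelopingGroup.

Section GeneratingImage.
Variables (Q : quandleType) (G : groupType) (f : Q -> G).
Hypothesis f_hom : quandle_hom (f : Q -> Conj G).
Hypothesis f_gen : generates (range f).

(** The elements that, together with their inverses, conjugate the image of [f]
    into itself form a subgroup containing that image. The two-sided condition
    is what makes them closed under inversion: for an infinite subset, being
    sent into itself by [g] does not imply being sent into itself by [g^-1]. *)
Lemma conjugates_range : conjugates (range f) = range f.
Proof.
rewrite eqEsubset; split=> [_ [_ [x _ <-] [g _ <-]]|_ [x _ <-]]; last first.
  by exists (f x); [exists x | exists 1; rewrite // mul1g invg1 mulg1].
pose N := [set g : G | forall z, range f z ->
  range f (g * z * g^-1) /\ range f (g^-1 * z * g)].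
suff /(_ (f x)) [] : N g by [exists x | ].
have : [set: G] g by [].
rewrite -f_gen; apply; split; last first.
  move=> _ [y _ <-] _ [z _ <-]; split.
    by exists (qop z y) => //; rewrite f_hom.
  (* Conjugation by [(f y)^-1] undoes the right translation by [y]. *)
  have [t [-> _]] := qop_div z y.
  by exists t => //; rewrite f_hom /= /qop /= /conj_op !mulgA mulVg mul1g mulgVK.
split=> [z|a b Na Nb z Sz|a Na z Sz]; first by rewrite invg1 mul1g mulg1.
  rewrite invgM; split.
    have [/Na[]] := Nb _ Sz; by rewrite !mulgA.
  have [_ /Nb[_]] := Na _ Sz; by rewrite !mulgA.
by have [] := Na _ Sz; rewrite invgK.
Qed.

Lemma dehn_iso_of_embedding (S0 : range f !=set0) :
  injective f -> quandle_iso Q (Dehn S0).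
Proof.
move=> f_inj.
have fS x : f x \in conjugates (range f).
  by rewrite conjugates_range inE; exists x.
pose F x : Dehn S0 := exist _ (f x) (fS x).
have /choice[h hP] (d : Dehn S0) : exists x, f x = val d.
  case: d => g /= gS; move: (gS); rewrite conjugates_range inE.
  by case=> x _ <-; exists x.
exists F; split=> [x y|]; first by apply: val_inj; rewrite /= f_hom.
exists h => [x|d]; first by apply: f_inj; rewrite hP.
by apply: val_inj; rewrite /= hP.
Qed.

End GeneratingImage.

Lemma dehn_embeds (G : groupType) (S : set G) (S0 : S !=set0) :
  quandle_embeds (Dehn S0) (Conj G).
Proof. by exists val; split=> //; apply: val_inj. Qed.

Lemma quandle_iso_embeds (P Q R : quandleType) :
  quandle_iso P Q -> quandle_embeds Q R -> quandle_embeds P R.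
Proof.
move=> [f [f_hom /bij_inj f_inj]] [g [g_hom g_inj]]; exists (g \o f).
by split=> [x y|]; [rewrite /= f_hom g_hom | apply: inj_comp].
Qed.

Theorem proposition3p8 (Q : quandleType) :
  [<-> (exists H : groupType, quandle_embeds Q (Conj H));
       injective (@env_eta Q);
       (exists (G : groupType) (S : set G) (S0 : S !=set0),
          generates S /\ quandle_iso Q (Dehn S0))].
Proof.
tfae.
- by case=> H; apply: env_eta_inj_of_embedding.
- move=> eta_inj; have [x] := @quandle_inhabited Q.
  have S0 : range (@env_eta Q) !=set0 by exists (env_eta x); exists x.
  exists (Env Q), (range (@env_eta Q)), S0; split; first exact: env_eta_generates.
  by apply: dehn_iso_of_embedding eta_inj;
    [apply: env_eta_hom | apply: env_eta_generates].
- move=> [G [S [S0 [_ QS]]]]; exists G.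
  exact: quandle_iso_embeds QS (dehn_embeds S0).
Qed.
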